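(* Let $X$ be a smooth Banach space over $\mathbb{C}$ and let $T\in B(X)$ be a self-adjoint operator such that $\|T\|^2 I - T^2$ is strongly normal. Then $T$ is norm attaining if and only if either $\|T\|$ or $-\|T\|$ is an eigenvalue of $T$.
   Context: $B(X)$ is the space of bounded linear operators on $X$, $S_X=\{x\in X:\|x\|=1\}$, $X^*$ is the space of bounded linear functionals on $X$. $X$ is smooth if every $x\in S_X$ admits a unique $x^*\in S_{X^*}$ with $x^*(x)=1$. The duality mapping $J:X\to X^*$ of a smooth Banach space assigns to each $x$ the unique functional $J(x)$ with $\|J(x)\|=\|x\|$ and $J(x)(x)=\|x\|^2$. For $T\in B(X)$ the transpose $T':X^*\to X^*$ is $(T'f)(x)=f(Tx)$. $T\in B(X)$ is self-adjoint if $T'\circ J=J\circ T$; $T$ is strongly normal if $T=S^2$ for some self-adjoint $S\in B(X)$. $T$ is norm attaining if there is $x_1\in S_X$ with $\|Tx_1\|=\|T\|$. *)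

(* Defs.v *)
From HB Require Import structures.
From mathcomp Require Import all_boot all_order all_algebra.
From mathcomp Require Import complex.
From mathcomp Require Import all_classical all_reals all_analysis.

Set Implicit Arguments.
Unset Strict Implicit.
Unset Printing Implicit Defensive.

Import Order.TTheory GRing.Theory Num.Theory.
Import numFieldNormedType.Exports.

Local Open Scope classical_set_scope.
Local Open Scope complex_scope.
Local Open Scope ring_scope.

Section bounded_operators.
Context {K : numFieldType}.
Implicit Types U V W : normedModType K.

Definition bounded_linear V W : {pred V -> W} :=
  mem [set f : V -> W | linear f /\ exists M : K, forall x, `|f x| <= M * `|x|].

Lemma bounded_linearP V W (f : V -> W) :
  reflect (linear f /\ exists M : K, forall x, `|f x| <= M * `|x|)
          (f \in @bounded_linear V W).
Proof. by apply: (iffP idP) => [/set_mem|/mem_set]. Qed.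

Lemma bounded_linear_submod_closed V W : submod_closed (@bounded_linear V W).
Proof.
split=> [|a f g /bounded_linearP[lf [M fM]] /bounded_linearP[lg [N gN]]].
  apply/bounded_linearP; split=> [b x y|].
    by rewrite /= scaler0 addr0.
  by exists 0 => x; rewrite /= normr0 mul0r.
apply/bounded_linearP; split=> [b x y|].
  rewrite !fctE lf lg !scalerDr !scalerA [a * b]mulrC -!scalerA.
  by rewrite addrACA.
exists (`|a| * M + N) => x; rewrite !fctE mulrDl (le_trans (ler_normD _ _))//.
by rewrite lerD// normrZ -mulrA ler_wpM2l.
Qed.

HB.instance Definition _ V W :=
  GRing.isSubmodClosed.Build K (V -> W) (@bounded_linear V W)
    (@bounded_linear_submod_closed V W).

Record boundedOp V W := BoundedOp {
  boundedOp_fun :> V -> W ;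
  boundedOpP : boundedOp_fun \in @bounded_linear V W }.

HB.instance Definition _ V W := [isSub for @boundedOp_fun V W].
HB.instance Definition _ V W := [Choice of boundedOp V W by <:].
HB.instance Definition _ V W := [SubChoice_isSubLmodule of boundedOp V W by <:].

Lemma boundedOp_id_subproof V : (id : V -> V) \in @bounded_linear V V.
Proof. by apply/bounded_linearP; split=> //; exists 1 => x; rewrite mul1r. Qed.

Definition boundedOp_id V : boundedOp V V :=
  BoundedOp (boundedOp_id_subproof V).

Lemma boundedOp_comp_subproof U V W (S : boundedOp V W) (T : boundedOp U V) :
  (S \o T : U -> W) \in @bounded_linear U W.
Proof.
have /bounded_linearP[lS [M SM]] := boundedOpP S.
have /bounded_linearP[lT [N TN]] := boundedOpP T.
apply/bounded_linearP; split=> [a x y|]; first by rewrite /= lT lS.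
exists (`|M| * N) => x; rewrite /= (le_trans (SM _))// -mulrA.
have [M0|M0] := boolP (0 <= M).
  by rewrite ger0_norm// ler_wpM2l.
have := SM (T x).
have [/eqP->|Tx0] := boolP (`|T x| == 0).
  by move=> _; rewrite mulr0 mulr_ge0// (le_trans _ (TN x)).
move=> h; case/negP: M0.
have Txp : 0 < `|T x| by rewrite lt_def Tx0 normr_ge0.
by rewrite -(pmulr_lge0 _ Txp) (le_trans _ h).
Qed.

Definition boundedOp_comp U V W (S : boundedOp V W) (T : boundedOp U V) :
  boundedOp U W := BoundedOp (boundedOp_comp_subproof S T).

Definition dual V := boundedOp V K^o.

Definition transpose V (T : boundedOp V V) (f : dual V) : dual V :=
  boundedOp_comp f T.

Definition is_eigenvalue V (T : boundedOp V V) (a : K) : Prop :=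
  exists2 x : V, x != 0 & T x = a *: x.

End bounded_operators.

Section smooth_spaces.
Context {R : realType}.
Implicit Types V W X : normedModType R[i].

(* The norm of a complex normed module takes its values in [R[i]] (it is real
   and nonnegative there); real parts are taken so that the supremum can be
   formed in [R]. *)
Definition opnorm V W (T : boundedOp V W) : R :=
  sup [set complex.Re `|T x| | x in [set x : V | `|x| <= 1]].

Definition smooth X : Prop :=
  forall x : X, `|x| = 1 ->
    exists! f : dual X, opnorm f = 1 /\ f x = 1.

(* When [X] is smooth, exactly one functional satisfies the two conditions;
   otherwise the value of [duality_map] is a junk one. *)
Definition duality_map X (x : X) : dual X :=
  xget 0 [set f : dual X | (opnorm f)%:C = `|x| /\ f x = `|x| ^+ 2].

Definition self_adjoint X (T : boundedOp X X) : Prop :=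
  transpose T \o @duality_map X = @duality_map X \o T.

Definition strongly_normal X (T : boundedOp X X) : Prop :=
  exists2 S : boundedOp X X, self_adjoint S & T = boundedOp_comp S S.

Definition norm_attaining X (T : boundedOp X X) : Prop :=
  exists2 x : X, `|x| = 1 & `|T x| = (opnorm T)%:C.

End smooth_spaces.

(* Main.v *)
Require Import Defs.
From mathcomp Require Import all_boot all_order all_algebra.
From mathcomp Require Import complex.
From mathcomp Require Import all_classical all_reals all_analysis.
Import Order.TTheory GRing.Theory Num.Theory.
Import numFieldNormedType.Exports.
Local Open Scope classical_set_scope.
Local Open Scope complex_scope.
Local Open Scope ring_scope.

(** Write [c] for the norm of [T] and [J] for the duality mapping. A
    self-adjoint operator [S] satisfies [J x (S (S x)) = `|S x| ^+ 2]
    ([duality_map_sqr]): moving one copy of [S] across [J] turns the left-hand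
    side into [J (S x) (S x)]. Let [x] be a unit vector at which [T] attains its
    norm, and let [S] be a self-adjoint square root of [c ^+ 2 - T ^+ 2].
    Applying the identity to [S] and to [T] gives
    [`|S x| ^+ 2 = J x (c ^+ 2 *: x - T (T x)) = c ^+ 2 - `|T x| ^+ 2 = 0],
    so [S x = 0] and therefore [T (T x) = c ^+ 2 *: x]. Since
    [T ^+ 2 - c ^+ 2 = (T - c) (T + c)], either [x] is an eigenvector for [- c]
    or [T x + c *: x] is one for [c] ([eigenvalue_of_sqr]).
    Conversely a normalised eigenvector for [c] or [- c] is a vector at which
    [T] attains its norm, because [c] is nonnegative.

    Smoothness provides a norming functional at each unit vector; rescaling it
    (with [opnormZ] for its norm) gives [J x x = `|x| ^+ 2]
    ([duality_map_self]). *)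

Section linearity.
Context {K : numFieldType} {V W : normedModType K}.
Implicit Types T : boundedOp V W.

Lemma boundedOp_linear T : linear T.
Proof. by have /bounded_linearP[] := boundedOpP T. Qed.

Lemma boundedOpD T : {morph T : x y / x + y}.
Proof. by move=> x y; rewrite -[x]scale1r boundedOp_linear !scale1r. Qed.

Lemma boundedOp0 T : T 0 = 0.
Proof. by apply: (addrI (T 0)); rewrite -boundedOpD !addr0. Qed.

Lemma boundedOpZ T a : {morph T : x / a *: x}.
Proof. by move=> x; rewrite -[a *: x]addr0 boundedOp_linear boundedOp0 addr0. Qed.

Lemma boundedOpB T : {morph T : x y / x - y}.
Proof. by move=> x y; rewrite -scaleN1r boundedOpD boundedOpZ scaleN1r. Qed.

End linearity.

(** Since [(T - a) (T + a)] kills [x], either [T + a] already does, or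
    [T x + a *: x] is a nonzero vector killed by [T - a]. *)
Lemma eigenvalue_of_sqr (K : numFieldType) (V : normedModType K)
    (T : boundedOp V V) (a : K) (x : V) :
  x != 0 -> T (T x) = a ^+ 2 *: x ->
  is_eigenvalue T a \/ is_eigenvalue T (- a).
Proof.
move=> x0 TTx; have [/eqP Txa|Txa] := eqVneq (T x + a *: x) 0.
  by right; exists x => //; apply/eqP; rewrite scaleNr -addr_eq0.
left; exists (T x + a *: x) => //.
by rewrite boundedOpD boundedOpZ TTx scalerDr scalerA -expr2 addrC.
Qed.

Section operator_norm.
Context {R : realType} {V W : normedModType R[i]}.
Implicit Types T : boundedOp V W.

Lemma Re_norm (U : normedModType R[i]) (x : U) :
  (complex.Re `|x|)%:C = `|x|.
Proof. by rewrite RRe_real// normr_real. Qed.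

Lemma has_sup_opnorm T :
  has_sup [set complex.Re `|T x| | x in [set x : V | `|x| <= 1]].
Proof.
have /bounded_linearP[_ [M TM]] := boundedOpP T.
split; first by exists (complex.Re `|T 0|), 0 => //=; rewrite normr0.
exists (complex.Re `|M|) => _ [x x1 <-].
rewrite -lecR !Re_norm (le_trans (TM x))//.
(* A bound [M] that is not nonnegative can only occur when [V] is trivial. *)
have [M0|M0] := boolP (0 <= M); first by rewrite ger0_norm// ler_piMr.
have [->|x0] := eqVneq x 0; first by rewrite normr0 mulr0.
by case/negP: M0; rewrite -(@pmulr_lge0 _ `|x|) ?normr_gt0// (le_trans _ (TM x)).
Qed.

Lemma opnorm_ge0 T : 0 <= opnorm T.
Proof.
apply: (ub_le_sup (has_sup_opnorm T).2).
by exists 0; rewrite /= ?normr0// boundedOp0 normr0.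
Qed.

Lemma opnormZ_le (a : R[i]) T :
  (opnorm (a *: T))%:C <= `|a| * (opnorm T)%:C.
Proof.
rewrite -[`|a|](RRe_real (normr_real a)) -rmorphM lecR.
apply: ge_sup; first exact: (has_sup_opnorm _).1.
move=> _ [x x1 <-].
have -> : complex.Re `|a *: T x| = complex.Re `|a| * complex.Re `|T x|.
  by apply: complexI; rewrite rmorphM/= !RRe_real ?normr_real// normrZ.
apply: ler_wpM2l; first by rewrite -lecR RRe_real ?normr_real ?normr_ge0.
by apply: (ub_le_sup (has_sup_opnorm T).2); exists x.
Qed.

Lemma opnormZ (a : R[i]) T : (opnorm (a *: T))%:C = `|a| * (opnorm T)%:C.
Proof.
apply/eqP; rewrite eq_le opnormZ_le /=.
have [->|a0] := eqVneq a 0.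
  by rewrite normr0 mul0r lecR opnorm_ge0.
(* The reverse bound is the direct one for the inverse scalar. *)
have := opnormZ_le a^-1 (a *: T).
by rewrite scalerA mulVf// scale1r normfV ler_pdivlMl ?normr_gt0.
Qed.

End operator_norm.

Section duality_mapping.
Context {R : realType} {X : normedModType R[i]}.

(** A norming functional at the normalisation of [x], scaled by [`|x|],
    satisfies both conditions that define [duality_map x]. *)
Lemma duality_map_self (x : X) : smooth X -> duality_map x x = `|x| ^+ 2.
Proof.
move=> smoothX; suff /(xgetPex 0)[] : exists f : dual X,
  (opnorm f)%:C = `|x| /\ f x = `|x| ^+ 2 by [].
have [->|x0] := eqVneq x 0.
  exists 0; split; last by rewrite normr0 expr0n.
  by rewrite -(scale0r (0 : dual X)) opnormZ !normr0 mul0r.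
have [f [[f1 fx] _]] := smoothX _ (normfZV x0).
exists (`|x| *: f); split; first by rewrite opnormZ f1 normr_id mulr1.
have -> : (`|x| *: f) x = `|x| * f x by [].
have {2}-> : x = `|x| *: (`|x|^-1 *: x).
  by rewrite scalerA mulfV ?normr_eq0// scale1r.
by rewrite boundedOpZ fx expr2 [_ *: _]mulr1.
Qed.

(** Self-adjointness at [x], evaluated at [S x], reads
    [duality_map x (S (S x)) = duality_map (S x) (S x)]. *)
Lemma duality_map_sqr (S : boundedOp X X) (x : X) :
  smooth X -> self_adjoint S -> duality_map x (S (S x)) = `|S x| ^+ 2.
Proof.
move=> smoothX saS; rewrite -duality_map_self//.
by have /(congr1 (fun F : X -> dual X => F x (S x))) := saS.
Qed.

End duality_mapping.

Theorem proposition1 (R : realType) (X : completeNormedModType R[i])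
    (T : boundedOp X X)
    (smoothX : smooth X)
    (saT : self_adjoint T)
    (snT : strongly_normal
             ((opnorm T)%:C ^+ 2 *: boundedOp_id X - boundedOp_comp T T)) :
  norm_attaining T <->
  (is_eigenvalue T (opnorm T)%:C \/ is_eigenvalue T (- (opnorm T)%:C)).
Proof.
set c := (opnorm T)%:C; have c0 : 0 <= c by rewrite lecR opnorm_ge0.
split=> [[x x1 Tx]|]; last first.
  move=> eigT; have [x x0 Tx] : exists2 x, x != 0 & `|T x| = c * `|x|.
    by case: eigT => -[x x0 Tx]; exists x; rewrite // Tx normrZ ?normrN ger0_norm.
  exists (`|x|^-1 *: x); first exact: normfZV.
  by rewrite boundedOpZ normrZ Tx mulrCA -normrZ normfZV// mulr1.
have [S saS /(congr1 (fun F : boundedOp X X => F x)) SSx] := snT.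
have {}SSx : c ^+ 2 *: x - T (T x) = S (S x) := SSx.
have Sx0 : S x = 0.
  apply/eqP; rewrite -normr_eq0 -sqrf_eq0 -duality_map_sqr// -SSx.
  rewrite boundedOpB boundedOpZ duality_map_self// duality_map_sqr// Tx x1.
  by rewrite expr1n [_ *: _]mulr1 subrr.
apply: (@eigenvalue_of_sqr _ _ _ _ x); first by rewrite -normr_eq0 x1 oner_eq0.
by apply/esym/eqP; rewrite -subr_eq0 SSx Sx0 boundedOp0.
Qed.
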